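(* Let $\emptyset\neq H\subset\mathbb R^n$, let $A\colon[0,\infty)\to\mathbb R^{n\times n}$ and $f\colon[0,\infty)\times\mathbb R^n\to\mathbb R^n$ be continuous, and suppose that $x'=A(t)x$ has an exponential contraction or an exponential expansion on $[0,\infty)$ with constants $N,\lambda>0$. Suppose there exist $\delta,L>0$ such that $|f(t,x_1)-f(t,x_2)|\le L|x_1-x_2|$ for all $t\ge0$ and $x_1,x_2\in\mathcal N_\delta(H)$. If $L<\dfrac{\lambda}{N}$, then $x'=A(t)x+f(t,x)$ has the conditional Lipschitz shadowing property in $H$.
   Context: $|\cdot|$ is a fixed norm on $\mathbb R^n$ and also denotes the induced matrix norm. $B_\delta(x)=\{y:|y-x|\le\delta\}$ and $\mathcal N_\delta(H)=\bigcup_{x\in H}B_\delta(x)$. For continuous $g\colon[0,\infty)\times\mathbb R^n\to\mathbb R^n$ and $\tau\in(0,\infty]$, a pseudosolution of $x'=g(t,x)$ on $[0,\tau)$ is a $C^1$ map $y\colon[0,\tau)\to\mathbb R^n$ with $\sigma_y:=\sup_{0\le t<\tau}|y'(t)-g(t,y(t))|<\infty$. The equation has the conditional Lipschitz shadowing property in $H\neq\emptyset$ if there exist $\varepsilon_0,\kappa>0$ such that whenever $0<\varepsilon\le\varepsilon_0$ and $y$ is a pseudosolution on $[0,\tau)$ ($\tau\in(0,\infty]$) with $\sigma_y\le\varepsilon$ and $y(t)\in H$ for all $t\in[0,\tau)$, there is a solution $x$ on $[0,\tau)$ with $\sup_{0\le t<\tau}|x(t)-y(t)|\le\kappa\varepsilon$.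 With $T(t,s)$ the transition matrix of $x'=A(t)x$: an exponential dichotomy on $[0,\infty)$ consists of projections $P(t)$ and constants $N,\lambda>0$ with $P(t)T(t,s)=T(t,s)P(s)$, $|T(t,s)P(s)|\le Ne^{-\lambda(t-s)}$ for $t\ge s\ge0$, and $|T(t,s)(I-P(s))|\le Ne^{-\lambda(s-t)}$ for $0\le t\le s$. It is an exponential contraction if moreover $P(t)=I$ for all $t$, and an exponential expansion if $P(t)=0$ for all $t$. *)

(* Defs.v *)
From HB Require Import structures.
From mathcomp Require Import all_boot all_order all_algebra.
From mathcomp Require Import all_classical all_reals all_analysis.
Set Implicit Arguments. Unset Strict Implicit. Unset Printing Implicit Defensive.
Import Order.TTheory GRing.Theory Num.Theory numFieldNormedType.Exports.
Local Open Scope classical_set_scope.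
Local Open Scope ring_scope.

Definition is_norm (R : realType) (n : nat) (nrm : 'cV[R]_n -> R) : Prop :=
  (forall x, 0 <= nrm x) /\
  (forall x, nrm x = 0 -> x = 0) /\
  (forall (a : R) x, nrm (a *: x) = `|a| * nrm x) /\
  (forall x y, nrm (x + y) <= nrm x + nrm y).

Definition opnorm (R : realType) (n : nat) (nrm : 'cV[R]_n -> R) (M : 'M[R]_n) : R :=
  sup [set nrm (M *m x) | x in [set x | nrm x <= 1]].

Definition cball (R : realType) (n : nat) (nrm : 'cV[R]_n -> R) (d : R) (x : 'cV[R]_n)
  : set 'cV[R]_n := [set y | nrm (y - x) <= d].
Definition nbhd_set (R : realType) (n : nat) (nrm : 'cV[R]_n -> R) (d : R)
  (H : set 'cV[R]_n) : set 'cV[R]_n := \bigcup_(x in H) cball nrm d x.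

(* derivative of a matrix/vector valued function relative to a set I of reals
   (one-sided at endpoints of an interval): yd t is the derivative of y at t in I *)
Definition has_deriv_on (R : realType) (p q : nat) (I : set R)
  (y : R -> 'M[R]_(p, q)) (yd : R -> 'M[R]_(p, q)) : Prop :=
  forall t, I t ->
    (fun s => (s - t)^-1 *: (y s - y t)) @ within (fun s => I s /\ s != t) (nbhs t)
      --> yd t.

Definition Ico0 (R : realType) (tau : \bar R) : set R :=
  [set t | 0 <= t /\ (t%:E < tau)%E].


Definition transition_matrix (R : realType) (n : nat) (A : R -> 'M[R]_n)
  (T : R -> R -> 'M[R]_n) : Prop :=
  forall s, 0 <= s -> T s s = 1%:M /\
    has_deriv_on [set t : R | 0 <= t] (fun t => T t s) (fun t => A t *m T t s).

Definition exp_dichotomy (R : realType) (n : nat) (nrm : 'cV[R]_n -> R)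
  (T : R -> R -> 'M[R]_n) (P : R -> 'M[R]_n) (N lam : R) : Prop :=
  0 < N /\ 0 < lam /\
  (forall t, 0 <= t -> P t *m P t = P t) /\
  (forall t s, 0 <= t -> 0 <= s -> P t *m T t s = T t s *m P s) /\
  (forall t s, 0 <= s -> s <= t ->
     opnorm nrm (T t s *m P s) <= N * expR (- lam * (t - s))) /\
  (forall t s, 0 <= t -> t <= s ->
     opnorm nrm (T t s *m (1%:M - P s)) <= N * expR (- lam * (s - t))).

Definition exp_contraction (R : realType) (n : nat) (nrm : 'cV[R]_n -> R)
  (T : R -> R -> 'M[R]_n) (N lam : R) : Prop :=
  exp_dichotomy nrm T (fun _ => 1%:M) N lam.

Definition exp_expansion (R : realType) (n : nat) (nrm : 'cV[R]_n -> R)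
  (T : R -> R -> 'M[R]_n) (N lam : R) : Prop :=
  exp_dichotomy nrm T (fun _ => 0) N lam.

Definition pseudosol_le (R : realType) (n : nat) (nrm : 'cV[R]_n -> R)
  (g : R -> 'cV[R]_n -> 'cV[R]_n) (tau : \bar R) (eps : R)
  (y yd : R -> 'cV[R]_n) : Prop :=
  has_deriv_on (Ico0 tau) y yd /\ {within Ico0 tau, continuous yd} /\
  (forall t, Ico0 tau t -> nrm (yd t - g t (y t)) <= eps).

Definition is_solution (R : realType) (n : nat)
  (g : R -> 'cV[R]_n -> 'cV[R]_n) (tau : \bar R) (x : R -> 'cV[R]_n) : Prop :=
  exists xd, has_deriv_on (Ico0 tau) x xd /\
    (forall t, Ico0 tau t -> xd t = g t (x t)).

Definition cond_lip_shadowing (R : realType) (n : nat) (nrm : 'cV[R]_n -> R)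
  (g : R -> 'cV[R]_n -> 'cV[R]_n) (H : set 'cV[R]_n) : Prop :=
  exists eps0 kappa : R, 0 < eps0 /\ 0 < kappa /\
    forall (eps : R) (tau : \bar R) (y yd : R -> 'cV[R]_n),
      0 < eps -> eps <= eps0 -> (0 < tau)%E ->
      pseudosol_le nrm g tau eps y yd ->
      (forall t, Ico0 tau t -> H (y t)) ->
      exists x, is_solution g tau x /\
        (forall t, Ico0 tau t -> nrm (x t - y t) <= kappa * eps).

(* Main.v *)
(* Write the sought solution as x = y + z. Then z' = A z + h with
   h = f(t, y + z) - f(t, y) - r and |r| <= eps, r being the residual of y. For
   bounded h this linear equation has a solution with |z| <= (N / lambda) sup |h|:
   the one with z(0) = 0 for a contraction, the one with T(0,t) z(t) -> 0 as
   t -> tau for an expansion. The bound comes from the mean value inequality for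
   s |-> T(t,s) z(s), whose derivative T(t,s) h(s) is dominated by that of a
   scalar exponential. Since L N / lambda < 1, Picard iteration
   converges among the z with |z| <= kappa eps, where
   kappa = C / (1 - C L) and C = N / lambda; for kappa eps <= delta both y and
   y + z stay in the region where f is Lipschitz. *)
Require Import Defs.
From HB Require Import structures.
From mathcomp Require Import all_boot all_order all_algebra.
From mathcomp Require Import all_classical all_reals all_analysis.
From mathcomp Require Import ring lra.
Import Order.TTheory GRing.Theory Num.Theory numFieldNormedType.Exports.
Local Open Scope classical_set_scope.
Local Open Scope ring_scope.

Set Implicit Arguments.
Unset Strict Implicit.
Unset Printing Implicit Defensive.

(** * Limits of matrix products, determinants and inverses along a filter *)

Section MatrixLimits.
Context {R : realType}.

Lemma cvg_mxP T (F : set_system T) {FF : Filter F} p q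
    (u : T -> 'M[R]_(p, q)) (l : 'M[R]_(p, q)) :
  u @ F --> l <-> forall i j, (fun s => u s i j) @ F --> l i j.
Proof.
split=> [ul i j|ul A [P Pl sPA]].
  by move=> B Bl; have := @coord_continuous R p q i j l B Bl; exact: ul.
have FP : F [set s | forall i j, P i j (u s i j)].
  apply: filter_forall => i; apply: filter_forall => j.
  exact: (ul i j _ (Pl i j)).
by apply: (@filterS T F _ _ _ _ FP) => s Ps; exact: sPA.
Qed.

Lemma cvg_mulmx T (F : set_system T) {FF : Filter F} p q r
    (u : T -> 'M[R]_(p, q)) (v : T -> 'M[R]_(q, r))
    (l : 'M[R]_(p, q)) (m : 'M[R]_(q, r)) :
  u @ F --> l -> v @ F --> m -> (fun s => u s *m v s) @ F --> l *m m.
Proof.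
move=> /cvg_mxP ul /cvg_mxP vm; apply/cvg_mxP => i j; rewrite mxE.
rewrite (_ : (fun s => _) = (fun s => \sum_k u s i k * v s k j)); last first.
  by apply/funext => s; rewrite mxE.
apply: cvg_big => [|k _]; first exact: add_continuous.
exact: cvgM.
Qed.

Lemma cvg_det T (F : set_system T) {FF : Filter F} n (u : T -> 'M[R]_n)
    (l : 'M[R]_n) :
  u @ F --> l -> (fun s => \det (u s)) @ F --> \det l.
Proof.
move=> /cvg_mxP ul; rewrite /determinant.
apply: cvg_big => [|s _]; first exact: add_continuous.
apply: cvgM; first exact: cvg_cst.
by apply: cvg_big => [|i _]; [exact: mul_continuous|exact: ul].
Qed.

Lemma cvg_adj T (F : set_system T) {FF : Filter F} n (u : T -> 'M[R]_n)
    (l : 'M[R]_n) :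
  u @ F --> l -> (fun s => \adj (u s)) @ F --> \adj l.
Proof.
move=> /cvg_mxP ul; apply/cvg_mxP => i j; rewrite mxE.
rewrite (_ : (fun s => _) = (fun s => cofactor (u s) j i)); last first.
  by apply/funext => s; rewrite mxE.
apply: cvgM; first exact: cvg_cst.
apply: cvg_det; apply/cvg_mxP => k m; rewrite !mxE.
rewrite (_ : (fun s => _) = (fun s => u s (lift j k) (lift i m))).
  exact: ul.
by apply/funext => s; rewrite !mxE.
Qed.

Lemma cvg_unitmx T (F : set_system T) {FF : Filter F} n (u : T -> 'M[R]_n)
    (l : 'M[R]_n) :
  l \in unitmx -> u @ F --> l -> \forall s \near F, u s \in unitmx.
Proof.
rewrite unitmxE unitfE => l0 /cvg_det ul.
have u0 : \forall s \near F, \det (u s) != 0 by exact: cvgr_neq0 ul l0.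
by apply: (@filterS T F _ _ _ _ u0) => s us; rewrite unitmxE unitfE.
Qed.

(** By the adjugate formula the inverse is a continuous expression in the entries wherever the
    determinant is nonzero, and the determinant of [u s] is eventually nonzero because that of [l]
    is. *)
Lemma cvg_invmx T (F : set_system T) {FF : Filter F} n (u : T -> 'M[R]_n)
    (l : 'M[R]_n) :
  l \in unitmx -> u @ F --> l -> (fun s => invmx (u s)) @ F --> invmx l.
Proof.
move=> lu ul; have uu : \forall s \near F, u s \in unitmx by exact: cvg_unitmx lu ul.
rewrite [invmx l]/invmx lu.
have E : \forall s \near F, (\det (u s))^-1 *: \adj (u s) = invmx (u s).
  by move: uu; apply: filterS => s us; rewrite /invmx us.
apply: (cvg_trans (near_eq_cvg E)).
apply: cvgZ; last exact: cvg_adj.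
by apply: cvgV; [rewrite -unitfE -unitmxE|exact: cvg_det].
Qed.

End MatrixLimits.

(** * Induction along a compact real interval *)

Section RealInduction.
Context {R : realType}.

(** Let [c] be the supremum of the points reachable from [a]. Some reachable point is close enough
    to [c] to make [c] reachable, and if [c < b] the local hypothesis reaches a point beyond [c].
    This turns local estimates into global ones, both for the mean value inequality and for
    uniqueness of linear solutions. *)
Lemma real_induction (P : R -> R -> Prop) (a b : R) : a <= b ->
  (forall s, P s s) ->
  (forall s t u, s <= t -> t <= u -> P s t -> P t u -> P s u) ->
  (forall c, a <= c <= b -> exists2 d, 0 < d & forall s, a <= s <= b ->
     `|s - c| < d -> (s <= c -> P s c) /\ (c <= s -> P c s)) ->
  P a b.
Proof.
move=> ab Prefl Ptrans Ploc.
pose S := [set t | a <= t <= b /\ P a t].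
have Sa : S a by split; [rewrite lexx ab|exact: Prefl].
have supS : has_sup S by split; [exists a|exists b => t [/andP[]]].
pose c := sup S.
have ac : a <= c by apply: ub_le_sup => //; case: supS.
have cb : c <= b by apply: ge_sup => [|t [/andP[]]//]; exists a.
have [d d0 Pd] := Ploc c (introT andP (conj ac cb)).
have [t St ct] := sup_adherent d0 supS; rewrite -/c in ct.
have tc : t <= c by apply: ub_le_sup => //; case: supS.
have Pac : P a c.
  case: St => /andP[at_ tb] Pat; apply: Ptrans Pat _ => //.
  by apply: (Pd t _ _).1; rewrite ?at_ ?tb// distrC ger0_norm; lra.
have [bc|cltb] := leP b c; first by rewrite (@le_anti _ _ b c) ?bc ?cb.
pose s := Num.min b (c + d / 2).
have cs : c < s by rewrite lt_min cltb; lra.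
have sb : s <= b by rewrite ge_min lexx.
have sd : s <= c + d / 2 by rewrite ge_min lexx orbT.
have : S s.
  split; first by rewrite sb andbT; lra.
  apply: Ptrans Pac _ => //; first exact: ltW.
  apply: (Pd s _ _).2; [by rewrite sb andbT; lra| |exact: ltW].
  by rewrite ger0_norm; lra.
move=> Ss; have : s <= c by apply: ub_le_sup => //; case: supS.
by lra.
Qed.

End RealInduction.

(** * Differentiation rules relative to a set of reals *)

Section Derivatives.
Context {R : realType}.

(** The pointwise form of [has_deriv_on], which unfolds to it at each point of [I]. *)
Definition has_deriv_at p q (I : set R) (y : R -> 'M[R]_(p, q)) (t : R)
    (l : 'M[R]_(p, q)) :=
  (fun s => (s - t)^-1 *: (y s - y t))
    @ within (fun s => I s /\ s != t) (nbhs t) --> l.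

Lemma has_deriv_cvg p q (I : set R) (y : R -> 'M[R]_(p, q)) t l :
  has_deriv_at I y t l -> y @ within (fun s => I s /\ s != t) (nbhs t) --> y t.
Proof.
move=> yl.
have idc : (fun s : R => s - t) @ within (fun s => I s /\ s != t) (nbhs t)
    --> t - t.
  apply: cvgB; last exact: cvg_cst.
  exact: cvg_within.
have E : \forall s \near within (fun s => I s /\ s != t) (nbhs t),
    y t + (s - t) *: ((s - t)^-1 *: (y s - y t)) = y s.
  rewrite near_withinE; apply: nearW => s [_ st].
  by rewrite scalerA divff ?subr_eq0// scale1r addrC subrK.
apply: (cvg_trans (near_eq_cvg E)).
have := cvgD (cvg_cst (y t)) (cvgZ idc yl).
by rewrite subrr scale0r addr0; apply.
Qed.

Lemma has_deriv_continuous p q (I : set R) (y : R -> 'M[R]_(p, q)) t l :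
  has_deriv_at I y t l -> y @ within I (nbhs t) --> y t.
Proof.
move=> /has_deriv_cvg yt.
move=> A At; have H : nbhs t [set s | I s /\ s != t -> A (y s)] by exact: yt.
change (nbhs t [set s | I s -> A (y s)]).
apply: filterS H => s /= H Is.
have [->|st] := eqVneq s t; first exact: nbhs_singleton.
exact: H.
Qed.

Lemma has_deriv_subset p q (I J : set R) (y : R -> 'M[R]_(p, q)) t l :
  J `<=` I -> has_deriv_at I y t l -> has_deriv_at J y t l.
Proof.
move=> JI yl A /yl H.
have {}H : nbhs t [set s | I s /\ s != t -> A ((s - t)^-1 *: (y s - y t))].
  exact: H.
change (nbhs t [set s | J s /\ s != t -> A ((s - t)^-1 *: (y s - y t))]).
by apply: filterS H => s /= H [/JI Is st]; exact: H.
Qed.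

Lemma has_deriv_ext p q (I : set R) (y z : R -> 'M[R]_(p, q)) t l :
  I t -> (forall s, I s -> y s = z s) ->
  has_deriv_at I y t l -> has_deriv_at I z t l.
Proof.
move=> It yz yl A /yl H.
have {}H : nbhs t [set s | I s /\ s != t -> A ((s - t)^-1 *: (y s - y t))].
  exact: H.
change (nbhs t [set s | I s /\ s != t -> A ((s - t)^-1 *: (z s - z t))]).
by apply: filterS H => s /= H [Is st]; rewrite -!yz//; exact: H.
Qed.

Lemma has_deriv_cst p q (I : set R) (c : 'M[R]_(p, q)) t :
  has_deriv_at I (fun=> c) t 0.
Proof.
rewrite /has_deriv_at (_ : (fun s => _) = fun=> 0); first exact: cvg_cst.
by apply/funext => s; rewrite subrr scaler0.
Qed.

Lemma has_derivB p q (I : set R) (y z : R -> 'M[R]_(p, q)) t l m :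
  has_deriv_at I y t l -> has_deriv_at I z t m ->
  has_deriv_at I (fun s => y s - z s) t (l - m).
Proof.
move=> yl zm; rewrite /has_deriv_at.
rewrite (_ : (fun s => _) = fun s => (s - t)^-1 *: (y s - y t)
    - (s - t)^-1 *: (z s - z t)); first exact: cvgB.
apply/funext => s; rewrite -scalerBr; congr (_ *: _).
by rewrite !opprD !opprK addrACA.
Qed.

Lemma has_deriv_mulmx p q r (I : set R) (y : R -> 'M[R]_(p, q))
    (z : R -> 'M[R]_(q, r)) t l m : I t ->
  has_deriv_at I y t l -> has_deriv_at I z t m ->
  has_deriv_at I (fun s => y s *m z s) t (l *m z t + y t *m m).
Proof.
move=> It yl zm; rewrite /has_deriv_at.
rewrite (_ : (fun s => _) = fun s => ((s - t)^-1 *: (y s - y t)) *m z s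
    + y t *m ((s - t)^-1 *: (z s - z t))); last first.
  apply/funext => s; rewrite -scalemxAl -scalemxAr -scalerDr; congr (_ *: _).
  by rewrite mulmxBl mulmxBr addrA subrK.
apply: cvgD; apply: cvg_mulmx => //; last exact: cvg_cst.
exact: has_deriv_cvg zm.
Qed.

(** Near [t] the difference quotient is computed exactly by the identity Y^-1 - Z^-1 = - Y^-1 (Y -
    Z) Z^-1, and each factor converges. *)
Lemma has_deriv_invmx n (I : set R) (y : R -> 'M[R]_n) t l :
  I t -> y t \in unitmx -> has_deriv_at I y t l ->
  has_deriv_at I (fun s => invmx (y s)) t (- (invmx (y t) *m l *m invmx (y t))).
Proof.
move=> It yt yl.
have yc := has_deriv_cvg yl.
have E : \forall s \near within (fun s => I s /\ s != t) (nbhs t),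
    - (invmx (y s) *m ((s - t)^-1 *: (y s - y t)) *m invmx (y t)) =
    (s - t)^-1 *: (invmx (y s) - invmx (y t)).
  have U : \forall s \near within (fun s => I s /\ s != t) (nbhs t),
    y s \in unitmx by exact: cvg_unitmx yt yc.
  move: U; apply: filterS => s ys.
  rewrite -scalemxAr -scalemxAl -scalerN; congr (_ *: _).
  by rewrite mulmxBr mulVmx// mulmxBl mul1mx mulmxK// opprB.
apply: (cvg_trans (near_eq_cvg E)).
apply: cvgN; apply: cvg_mulmx; last exact: cvg_cst.
by apply: cvg_mulmx; first exact: cvg_invmx.
Qed.

End Derivatives.

(** * Seminorms and the mean value inequality *)

Section MeanValue.
Context {R : realType}.

(** Definiteness is left out so that absolute values of single entries and maps such as x |-> |M x|
    are covered as well. *)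
Definition seminorm p q (nu : 'M[R]_(p, q) -> R) :=
  (forall a x, nu (a *: x) = `|a| * nu x) /\
  (forall x y, nu (x + y) <= nu x + nu y).

Section Seminorm.
Variables (p q : nat) (nu : 'M[R]_(p, q) -> R).
Hypothesis nuP : seminorm nu.

Lemma seminorm0 : nu 0 = 0.
Proof. by rewrite -(scale0r 0) nuP.1 normr0 mul0r. Qed.

Lemma seminormN x : nu (- x) = nu x.
Proof. by rewrite -scaleN1r nuP.1 normrN1 mul1r. Qed.

Lemma seminormBC x y : nu (x - y) = nu (y - x).
Proof. by rewrite -seminormN opprB. Qed.

Lemma seminorm_ge0 x : 0 <= nu x.
Proof.
have := nuP.2 x (- x); rewrite subrr seminorm0 seminormN.
by lra.
Qed.

Lemma seminormB_le x y : nu (x - y) <= nu x + nu y.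
Proof. by rewrite (le_trans (nuP.2 _ _))// seminormN. Qed.

Lemma seminorm_triangle z x y : nu (x - y) <= nu (x - z) + nu (z - y).
Proof. by rewrite (le_trans _ (nuP.2 _ _))// addrA subrK. Qed.

Lemma seminorm_sum (J : Type) (r : seq J) (F : J -> 'M[R]_(p, q)) :
  nu (\sum_(j <- r) F j) <= \sum_(j <- r) nu (F j).
Proof.
elim/big_ind2 : _ => [|x a y b xa yb|//]; first by rewrite seminorm0.
by rewrite (le_trans (nuP.2 _ _))// lerD.
Qed.

Lemma le_mx_norm (x : 'M[R]_(p, q)) i j : `|x i j| <= `|x|.
Proof.
rewrite [leRHS]/Num.norm /= mx_normrE.
exact: (le_bigmax _ (fun ij : 'I_p * 'I_q => `|x ij.1 ij.2|) (i, j)).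
Qed.

Lemma seminorm_le_norm : exists2 C, 0 < C & forall x, nu x <= C * `|x|.
Proof.
(* Expansion in matrix units gives the sum; the added 1 keeps the constant positive even when [nu]
   is zero. *)
exists (1 + \sum_i \sum_j nu (delta_mx i j)) => [|x].
  rewrite ltr_pwDl//; do 2 (apply: sumr_ge0 => ? _).
  exact: seminorm_ge0.
rewrite mulrDl mul1r ler_wpDl// {1}[x]matrix_sum_delta.
rewrite (le_trans (seminorm_sum _ _))// mulr_suml; apply: ler_sum => i _.
rewrite (le_trans (seminorm_sum _ _))// mulr_suml; apply: ler_sum => j _.
by rewrite nuP.1 mulrC ler_wpM2l ?seminorm_ge0 ?le_mx_norm.
Qed.

Lemma cvg_seminorm T (F : set_system T) {FF : Filter F}
    (u : T -> 'M[R]_(p, q)) (l : 'M[R]_(p, q)) (e : R) :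
  0 < e -> u @ F --> l -> \forall s \near F, nu (u s - l) <= e.
Proof.
move=> e0 ul; have [C C0 nuC] := seminorm_le_norm.
have eC0 : 0 < e / C by rewrite divr_gt0.
have H : \forall s \near F, `|l - u s| <= e / C by exact: cvgr_dist_le ul _ eC0.
move: H; apply: filterS => s; rewrite ler_pdivlMr// => H.
by rewrite seminormBC (le_trans (nuC _))// mulrC.
Qed.

Lemma has_deriv_seminorm (I : set R) y t l e :
  0 < e -> has_deriv_at I y t l ->
  exists2 d, 0 < d & forall s, I s -> `|s - t| < d ->
    nu (y s - y t - (s - t) *: l) <= e * `|s - t|.
Proof.
move=> e0 yl; have := cvg_seminorm e0 yl.
move=> /(_ (within_filter _ _)) H.
have {}H : nbhs t [set s | I s /\ s != t ->
    nu ((s - t)^-1 *: (y s - y t) - l) <= e] by exact: H.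
have [d /= d0 dP] := (nbhs_ballP _ _).1 H.
exists d => // s Is std.
have [->|st] := eqVneq s t.
  by rewrite !subrr scale0r subrr normr0 mulr0 seminorm0.
have := dP s; rewrite /ball /= distrC => /(_ std (conj Is st)) {}H.
have st0 : s - t != 0 by rewrite subr_eq0.
rewrite [y s - y t](_ : _ = (s - t) *: ((s - t)^-1 *: (y s - y t))); last first.
  by rewrite scalerA divff// scale1r.
by rewrite -scalerBr nuP.1 mulrC ler_wpM2r.
Qed.

End Seminorm.

Lemma is_derive_quot (phi : R -> R) (t l e : R) : 0 < e -> is_derive t 1 phi l ->
  exists2 d, 0 < d & forall s, `|s - t| < d ->
    `|phi s - phi t - (s - t) * l| <= e * `|s - t|.
Proof.
move=> e0 [dphi <-].
have H : \forall h \near (0 : R)^',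
    `|'D_1 phi t - h^-1 *: (phi (h *: 1 + t) - phi t)| <= e.
  exact: cvgr_dist_le dphi _ e0.
have {}H : nbhs (0 : R) [set h | h != 0 ->
  `|'D_1 phi t - h^-1 *: (phi (h *: 1 + t) - phi t)| <= e] by exact: H.
have [d /= d0 dP] := (nbhs_ballP _ _).1 H.
exists d => // s std.
have [->|st] := eqVneq s t.
  by rewrite !subrr mul0r subrr normr0 mulr0.
have st0 : s - t != 0 by rewrite subr_eq0.
have := dP (s - t); rewrite /ball /= sub0r normrN => /(_ std st0).
rewrite [_ *: 1]mulr1 subrK distrC => {}H.
rewrite [phi s - phi t](_ : _ = (s - t) * ((s - t)^-1 * (phi s - phi t))).
  by rewrite -mulrBr normrM mulrC ler_wpM2r.
by rewrite mulrA divff// mul1r.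
Qed.

(** Integration is avoided: with a slack proportional to the length, the inequality holds between
    each point and its neighbours directly from the definition of the derivative. It is additive by
    the triangle inequality, so real induction extends it to the whole interval, and then the slack
    tends to 0. *)
Lemma mean_value_le p q (nu : 'M[R]_(p, q) -> R) (I : set R)
    (y y' : R -> 'M[R]_(p, q)) (phi phi' : R -> R) (a b : R) :
  seminorm nu -> a <= b ->
  (forall t, a <= t <= b -> [/\ I t, has_deriv_at I y t (y' t),
     is_derive t 1 phi (phi' t) & nu (y' t) <= phi' t]) ->
  nu (y b - y a) <= phi b - phi a.
Proof.
move=> nuP ab H; apply/ler_addgt0Pr => e e0.
(* The total slack [k * (b - a)] is then at most [e]; the 1 covers the case a = b. *)
pose k := e / (b - a + 1).
have k0 : 0 < k by rewrite divr_gt0//; lra.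
suff : nu (y b - y a) <= phi b - phi a + k * (b - a).
  move/le_trans; apply; rewrite lerD2l /k mulrAC ler_pdivrMr; last by lra.
  by rewrite ler_wpM2l//; lra.
pose P s t := nu (y t - y s) <= phi t - phi s + k * (t - s).
apply: (@real_induction _ P) => //.
- by move=> s; rewrite /P !subrr mulr0 seminorm0 ?addr0.
- move=> r s t rs st; rewrite /P => Prs Pst.
  by have := seminorm_triangle nuP (y s) (y t) (y r); lra.
- move=> c cab; have [Ic dy dphi le] := H c cab.
  (* Half of the slack goes to the quotient of [y], half to that of [phi]. *)
  have k2 : 0 < k / 2 by lra.
  have [d1 d10 H1] := has_deriv_seminorm nuP k2 dy.
  have [d2 d20 H2] := is_derive_quot k2 dphi.
  exists (Num.min d1 d2) => [|s sab]; first by rewrite lt_min d10.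
  rewrite lt_min => /andP[sd1 sd2].
  have [Is _ _ _] := H s sab.
  have {}H1 := H1 s Is sd1; have {}H2 := H2 s sd2.
  have {}H1 : nu (y s - y c) <= (nu (y' c) + k / 2) * `|s - c|.
    have := nuP.2 (y s - y c - (s - c) *: y' c) ((s - c) *: y' c).
    rewrite subrK nuP.1 => H3; rewrite (le_trans H3)// mulrDl addrC [_ * nu _]mulrC.
    by rewrite lerD2l.
  have {}H1 : nu (y s - y c) <= (phi' c + k / 2) * `|s - c|.
    by rewrite (le_trans H1)// ler_wpM2r// lerD2r.
  move: H2; rewrite ler_norml => /andP[H2 H3].
  split=> sc.
    rewrite /P seminormBC//; move: H1 H2 H3; rewrite ler0_norm; last by lra.
    by nra.
  by rewrite /P; move: H1 H2 H3; rewrite ger0_norm; [nra|lra].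
Qed.

Lemma seminorm_entry p q (i : 'I_p) (j : 'I_q) :
  seminorm (fun x : 'M[R]_(p, q) => `|x i j|).
Proof.
split=> [a x|x y] /=; first by rewrite mxE normrM.
by rewrite mxE ler_normD.
Qed.

Lemma has_deriv0_const p q (I : set R) (y : R -> 'M[R]_(p, q)) (a b : R) :
  a <= b -> (forall t, a <= t <= b -> I t /\ has_deriv_at I y t 0) -> y a = y b.
Proof.
move=> ab H; apply/matrixP => i j; apply/eqP; rewrite eq_sym -subr_eq0.
rewrite -normr_le0.
have := @mean_value_le p q (fun x => `|x i j|) I y (fun=> 0) (cst 0) (cst 0) a b.
rewrite /= !mxE subr0; apply => //; first exact: seminorm_entry.
move=> t /H[It yt]; split=> //; first exact: is_derive_cst.
by rewrite /= normr0.
Qed.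

End MeanValue.

(** * Uniqueness for linear equations and the algebra of transition matrices *)

Section LinearODE.
Context {R : realType}.
Variables (n : nat) (A : R -> 'M[R]_n) (T : R -> R -> 'M[R]_n).
Hypothesis TA : transition_matrix A T.
Let J := [set t : R | 0 <= t].

Let T1 s : 0 <= s -> T s s = 1%:M.
Proof. by move=> s0; exact: (TA s0).1. Qed.

Let dT s t : 0 <= s -> 0 <= t -> has_deriv_at J (T^~ s) t (A t *m T t s).
Proof. by move=> s0 t0; exact: (TA s0).2 _ t0. Qed.

(* [T t c] is invertible for [t] near [c] and [T(t,c)^-1 X(t)] has derivative
   zero: local uniqueness, with no Gronwall estimate. *)
Lemma linear_solution_local q (X : R -> 'M[R]_(n, q)) c :
  has_deriv_on J X (fun t => A t *m X t) -> 0 <= c ->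
  exists2 d, 0 < d & forall s, 0 <= s -> `|s - c| < d ->
    T s c \in unitmx /\ X s = T s c *m X c.
Proof.
move=> dX c0.
have Tc := has_deriv_continuous (dT c0 c0).
have uc : T c c \in unitmx by rewrite T1// unitmx1.
have H : \forall s \near within J (nbhs c), T s c \in unitmx.
  exact: cvg_unitmx uc Tc.
have {}H : nbhs c [set s | J s -> T s c \in unitmx] by exact: H.
have [d /= d0 dP] := (nbhs_ballP _ _).1 H.
exists d => // s s0 scd.
have Tu t : 0 <= t -> `|t - c| < d -> T t c \in unitmx.
  by move=> t0 tcd; apply: (dP t) => //; rewrite /ball /= distrC.
have dY t : 0 <= t -> `|t - c| < d ->
    has_deriv_at J (fun t => invmx (T t c) *m X t) t 0.
  move=> t0 tcd; have ut := Tu t t0 tcd.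
  have := has_deriv_mulmx t0 (has_deriv_invmx t0 ut (dT c0 t0)) (dX t t0).
  by rewrite mulNmx !mulmxA mulmxK// addNr.
split; first exact: Tu.
suff : invmx (T s c) *m X s = X c by move <-; rewrite mulKVmx// Tu.
have [sc|/ltW cs] := leP s c.
  rewrite (has_deriv0_const sc (I := J) (y := fun t => invmx (T t c) *m X t)).
    by rewrite T1// invmx1 mul1mx.
  move=> t /andP[st tc]; have t0 := le_trans s0 st; split=> //; apply: dY => //.
  by move: scd; rewrite !ler0_norm; lra.
rewrite -(has_deriv0_const cs (I := J) (y := fun t => invmx (T t c) *m X t)).
  by rewrite T1// invmx1 mul1mx.
move=> t /andP[ct ts]; have t0 := le_trans c0 ct; split=> //; apply: dY => //.
by move: scd; rewrite !ger0_norm; lra.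
Qed.

(** Near [c] the values of [X] and [X c] differ by an invertible factor, so they vanish together.
    Real induction, applied to the relation of vanishing together, propagates this in both time
    directions. *)
Lemma linear_solution0 q (X : R -> 'M[R]_(n, q)) s t :
  has_deriv_on J X (fun t => A t *m X t) -> 0 <= s -> 0 <= t ->
  X s = 0 -> X t = 0.
Proof.
move=> dX.
suff H a b : 0 <= a -> a <= b -> (X a = 0 <-> X b = 0).
  move=> s0 t0; have [st|/ltW ts] := leP s t; first by move/(H _ _ s0 st).
  by move/(H _ _ t0 ts).
move=> a0 ab; apply: (@real_induction _ (fun s t => X s = 0 <-> X t = 0)) => //.
  by move=> ? ? ? _ _ -> ->.
move=> c /andP[ac cb]; have c0 := le_trans a0 ac.
have [d d0 dP] := linear_solution_local dX c0.
exists d => // r /andP[ar rb] rcd.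
have [ur Xr] := dP r (le_trans a0 ar) rcd.
have : X r = 0 <-> X c = 0.
  split=> [r0|c00]; last by rewrite Xr c00 mulmx0.
  by rewrite -[X c](mulKmx ur) -Xr r0 mulmx0.
by move=> E; split=> _; rewrite E.
Qed.

(** As functions of [t] the two sides solve the same linear equation and agree at t = s, so their
    difference vanishes identically. *)
Lemma transition_comp0 s t : 0 <= s -> 0 <= t -> T t s *m T s 0 = T t 0.
Proof.
move=> s0 t0; apply/eqP; rewrite -subr_eq0; apply/eqP.
apply: (@linear_solution0 _ (fun t => T t s *m T s 0 - T t 0) s t) => //.
  move=> r r0; have dc := @has_deriv_cst R n n J (T s 0) r.
  have := has_derivB (has_deriv_mulmx r0 (dT s0 r0) dc) (dT (lexx 0) r0).
  by rewrite mulmx0 addr0 -mulmxA -mulmxBr.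
by rewrite T1// mul1mx subrr.
Qed.

Lemma transition_unitmx s : 0 <= s -> T s 0 \in unitmx.
Proof.
move=> s0; have := transition_comp0 s0 (lexx 0); rewrite T1// => E.
exact: (mulmx1_unit E).2.
Qed.

Lemma transition_invmx s : 0 <= s -> T 0 s = invmx (T s 0).
Proof.
move=> s0; have := transition_comp0 s0 (lexx 0); rewrite T1// => E.
by rewrite -[LHS](mulmxK (transition_unitmx s0)) E mul1mx.
Qed.

Lemma transition_split s t : 0 <= s -> 0 <= t -> T t s = T t 0 *m T 0 s.
Proof.
move=> s0 t0; rewrite -(transition_comp0 s0 t0) -mulmxA transition_invmx//.
by rewrite mulmxV ?mulmx1// transition_unitmx.
Qed.

(** The definition of a transition matrix only differentiates in the first argument; writing T(t,s)
    = T(t,0) T(s,0)^-1 moves [s] into a first argument. *)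
Lemma has_deriv_transition s t : 0 <= s -> 0 <= t ->
  has_deriv_at J (T t) s (- (T t s *m A s)).
Proof.
move=> s0 t0.
apply: (@has_deriv_ext _ _ _ _ (fun s => T t 0 *m invmx (T s 0))) => //.
  by move=> r r0; rewrite (transition_split r0 t0) transition_invmx.
have us := transition_unitmx s0; have J0 : J s by [].
have dc := @has_deriv_cst R n n J (T t 0) s.
have := has_deriv_mulmx J0 dc (has_deriv_invmx J0 us (dT (lexx 0) s0)).
rewrite mul0mx add0r mulmxN -!mulmxA mulmxV// mulmx1 mulmxA.
by rewrite -transition_invmx// -transition_split.
Qed.

End LinearODE.

(** * Equivalence of norms and the operator norm *)

Section Norms.
Context {R : realType}.
Variables (n : nat) (nrm : 'cV[R]_n -> R).
Hypothesis nrmP : is_norm nrm.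

Lemma is_norm_seminorm : seminorm nrm.
Proof. by case: nrmP => _ [_ []]. Qed.

(** On the compact unit sphere of the maximum norm, [nrm] attains a positive minimum; its inverse is
    the constant, by homogeneity. *)
Lemma norm_equiv : exists2 c, 0 < c & forall x, `|x| <= c * nrm x.
Proof.
have [nrm_ge0 [nrm0 _]] := nrmP; have semi := is_norm_seminorm.
(* The sphere is taken among row vectors, where bounded closed sets are known to be compact, and is
   transferred to columns by transposition. *)
pose S := [set v : 'rV[R]_n | `|v| = 1].
have trC (x : 'cV[R]_n) : `|x| <= `|x^T|.
  rewrite [leLHS]/Num.norm /= mx_normrE; apply: bigmax_le => // -[i j] _ /=.
  by have := le_mx_norm x^T j i; rewrite mxE.
have Sx (x : 'cV[R]_n) : x != 0 -> S (`|x^T|^-1 *: x^T).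
  move=> x0; have x0' : `|x^T| != 0.
    by rewrite normr_eq0; apply: contra x0 => /eqP x0; rewrite -[x]trmxK x0 trmx0.
  by rewrite /S /= normrZ normfV normr_id mulVf.
(* The sphere is empty only in dimension 0, where every vector is zero. *)
have [S0|/set0P S0] := eqVneq S set0.
  exists 1 => // x; have [->|x0] := eqVneq x 0; first by rewrite normr0 mul1r.
  by have := Sx x x0; rewrite S0.
have cS : compact S.
  apply: bounded_closed_compact.
    by exists 1; split=> // e e1 v /= ->; exact: ltW.
  have -> : S = (fun v : 'rV[R]_n => `|v|) @^-1` [set 1] by [].
  by apply: closed_comp => [v _|]; [exact: norm_continuous|exact: closed_eq].
have cf : {within S, continuous (fun v : 'rV[R]_n => nrm v^T)}.
  apply: continuous_subspaceT => v; apply/(@cvgrPdist_le _ _ _ _ (nbhs_filter v)) => e e0.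
  have vT : (fun u : 'rV[R]_n => u^T) @ nbhs v --> v^T.
    apply/(@cvg_mxP _ _ _ (nbhs_filter v)) => i j; rewrite mxE.
    rewrite (_ : (fun s => _) = fun u : 'rV[R]_n => u j i).
      exact: coord_continuous.
    by apply/funext => u; rewrite mxE.
  have {}vT : \forall u \near v, nrm (u^T - v^T) <= e.
    exact: (@cvg_seminorm _ _ _ _ semi _ _ (nbhs_filter v) _ _ _ e0 vT).
  move: vT; apply: filterS => u H.
  rewrite (le_trans _ H)// ler_norml.
  have := semi.2 (u^T - v^T) v^T; have := semi.2 (v^T - u^T) u^T.
  rewrite !subrK (seminormBC semi v^T) => H1 H2.
  by apply/andP; split; lra.
have [v vS vmin] := compact_EVT_min S0 cS cf.
have m0 : 0 < nrm v^T.
  rewrite lt_neqAle nrm_ge0 andbT eq_sym; apply/eqP => /nrm0 v0.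
  move: vS; rewrite inE /S /= -[v]trmxK v0 trmx0 normr0 => /eqP.
  by rewrite eq_sym oner_eq0.
exists (nrm v^T)^-1; first by rewrite invr_gt0.
move=> x; have [->|x0] := eqVneq x 0.
  by rewrite normr0 mulr_ge0// invr_ge0 ltW.
rewrite mulrC ler_pdivlMr// (le_trans (ler_wpM2r (nrm_ge0 _) (trC x)))//.
have x1 : 0 < `|x^T| by rewrite (lt_le_trans _ (trC x))// normr_gt0.
have := vmin _ (mem_set (Sx x x0)).
by rewrite linearZ /= trmxK semi.1 normfV normr_id mulrC ler_pdivlMr// mulrC.
Qed.

(** After normalising [x], the value lies in the set whose supremum is [opnorm]. The supremum is an
    upper bound only if that set is bounded, which is where equivalence of norms enters. *)
Lemma opnorm_le (M : 'M[R]_n) x : nrm (M *m x) <= opnorm nrm M * nrm x.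
Proof.
have [nrm_ge0 [nrm0 _]] := nrmP; have semi := is_norm_seminorm.
have [x0|x0] := eqVneq (nrm x) 0.
  by rewrite (nrm0 _ x0) mulmx0 seminorm0// mulr0.
have x1 : 0 < nrm x by rewrite lt_neqAle eq_sym x0 nrm_ge0.
rewrite -ler_pdivrMr//; apply: ub_le_sup.
  have semiM : seminorm (fun x => nrm (M *m x)).
    by split=> [a u|u v]; rewrite ?mulmxDr ?semi.2// -scalemxAr semi.1.
  have [C C0 CM] := seminorm_le_norm semiM.
  have [c c0 cN] := norm_equiv.
  exists (C * c) => _ [u /= u1 <-]; rewrite (le_trans (CM u))//.
  apply: ler_wpM2l; first exact: ltW.
  by rewrite (le_trans (cN u))// -{2}[c]mulr1 ler_wpM2l// ltW.
exists ((nrm x)^-1 *: x).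
  by rewrite /= semi.1 ger0_norm ?invr_ge0// mulVf.
by rewrite -scalemxAr semi.1 ger0_norm ?invr_ge0// mulrC.
Qed.

Lemma cvg_nrmP T (F : set_system T) {FF : Filter F} (u : T -> 'cV[R]_n) l :
  (forall e, 0 < e -> \forall s \near F, nrm (u s - l) <= e) -> u @ F --> l.
Proof.
move=> H; have [c c0 cN] := norm_equiv.
apply/cvgrPdist_le => e e0; have ec : 0 < e / c by rewrite divr_gt0.
apply: filterS (H _ ec) => s us; rewrite distrC (le_trans (cN _))//.
by rewrite mulrC -ler_pdivlMr.
Qed.

End Norms.

(** * Antiderivatives of continuous functions on a half-open interval *)

Section Antiderivative.
Context {R : realType}.
Variable tau : \bar R.
Hypothesis tau0 : (0 < tau)%E.
Notation I := (Ico0 tau).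

(** Gives the room to the right of [t] that a two-sided derivative at [t] requires. *)
Lemma Ico0_extend t : (t%:E < tau)%E -> exists2 u, t < u & (u%:E < tau)%E.
Proof.
case: tau => [r| |]//; rewrite ?lte_fin => tr.
  by exists ((t + r) / 2); rewrite ?lte_fin; lra.
by exists (t + 1); rewrite ?ltry//; lra.
Qed.

Lemma Ico0_le s t : 0 <= s -> s <= t -> I t -> I s.
Proof. by move=> s0 st [t0 tt]; split=> //; rewrite (le_lt_trans _ tt)// lee_fin. Qed.

Let antiderivative_scalar (h : R -> R) :
  (forall t, I t -> h @ within I (nbhs t) --> h t) ->
  exists F : R -> R, forall t, I t -> is_derive t 1 F (h t).
Proof.
move=> ch; (* extended to the left of 0, so that two-sided derivatives exist at 0 *)
pose h' s := h (Num.max 0 s).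
have ch' x : (x%:E < tau)%E -> {for x, continuous h'}.
  move=> xtau; have Ix : I (Num.max 0 x).
    split; first by rewrite le_max lexx.
    by have [_|_] := leP 0 x.
  move=> B hB.
  have {hB} : nbhs (Num.max 0 x) [set s | I s -> B (h s)] by exact: ch Ix _ hB.
  move=> /(nbhs_ballP _ _)[d /= d0 dB].
  have [u xu utau] := Ico0_extend xtau.
  apply/nbhs_ballP; exists (Num.min d (u - x)) => /=.
    by rewrite lt_min d0 subr_gt0.
  move=> s; rewrite /ball /= lt_min => /andP[sd su].
  apply: dB.
    rewrite /ball /=; apply: le_lt_trans sd.
    have [x0|x0] := leP 0 x; have [s0|s0] := leP 0 s => //.
    - by rewrite subr0 !ger0_norm//; lra.
    - by rewrite sub0r normrN distrC !ger0_norm//; lra.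
    - by rewrite subrr normr0 normr_ge0.
  split; first by rewrite le_max lexx.
  have [_|_] := leP 0 s => //; rewrite (lt_trans _ utau)// lte_fin.
  by have := ler_norm (s - x); move: su; rewrite distrC; lra.
(* Starting the integral at -1 makes every point of [I], including 0, interior to the domain of
   integration. *)
exists (fun x => \int[lebesgue_measure]_(t in
  [set` Interval (BLeft (-1)) (BRight x)]) h' t)%R.
move=> t [t0 ttau]; have [u tu utau] := Ico0_extend ttau.
have [] := @continuous_FTC1 R h' (BLeft (-1)) t u tu.
- apply: continuous_compact_integrable; first exact: segment_compact.
  apply: continuous_in_subspaceT => x; rewrite inE /= in_itv /= => /andP[_ xu].
  by apply: ch'; rewrite (le_lt_trans _ utau)// lee_fin.
- by rewrite lte_fin; lra.
- exact: ch'.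
move=> dF F't; split=> //.
by rewrite -derive1E F't /h' max_r.
Qed.

Lemma antiderivative n (h : R -> 'cV[R]_n) :
  (forall t, I t -> h @ within I (nbhs t) --> h t) ->
  exists G, has_deriv_on I G h /\ G 0 = 0.
Proof.
move=> ch.
have ex i : exists F : R -> R, forall t, I t -> is_derive t 1 F (h t i 0).
  by apply: antiderivative_scalar => t It; have /cvg_mxP := ch t It; apply.
have [F dF] := choice ex.
pose G t : 'cV[R]_n := \col_i F i t.
have dG t : I t -> has_deriv_at I G t (h t).
  move=> It; apply/cvg_mxP => i j; rewrite ord1.
  apply/cvgrPdist_le => e e0.
  have [d d0 dP] := is_derive_quot e0 (dF i t It).
  suff : nbhs t [set s | I s /\ s != t ->
    `|h t i 0 - ((s - t)^-1 *: (G s - G t)) i 0| <= e] by [].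
  apply/nbhs_ballP; exists d => // s; rewrite /ball /= distrC => std [_ st].
  have st0 : 0 < `|s - t| by rewrite normr_gt0 subr_eq0.
  have := dP s std; rewrite distrC !mxE -ler_pdivrMr//.
  rewrite -normfV -normrM mulrBl [(s - t) * _]mulrC mulfK ?subr_eq0//.
  by rewrite [_ / _]mulrC.
exists (fun t => G t - G 0); split; last exact: subrr.
move=> t It; have := has_derivB (dG t It) (@has_deriv_cst R n 1 I (G 0) t).
by rewrite subr0.
Qed.

End Antiderivative.

(** * Picard iteration for boundary value problems *)

Section FixedPoint.
Context {R : realType}.
Variables (n : nat) (nrm : 'cV[R]_n -> R).
Hypothesis nrmP : is_norm nrm.

Let semi : seminorm nrm := is_norm_seminorm nrmP.

Lemma exists_expr_le (K q e : R) : 0 <= q < 1 -> 0 <= K -> 0 < e ->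
  exists k, K * q ^+ k <= e.
Proof.
move=> /andP[q0 q1] K0 e0; have q1' : `|q| < 1 by rewrite ger0_norm.
have eK : 0 < e / (K + 1) by rewrite divr_gt0//; lra.
have [k _ qk] := cvgr_lt _ (cvg_expr q1') _ eK.
exists k; have := qk k (leqnn _); rewrite ltr_pdivlMr; last by lra.
have : 0 <= q ^+ k by rewrite exprn_ge0.
by nra.
Qed.

(** The factor [1 - q] in the increments is chosen so that the geometric tail from [k] on sums to
    exactly [K * q ^+ k]. *)
Lemma cvg_geometric_le (u : nat -> 'cV[R]_n) (K q : R) :
  0 <= q < 1 -> 0 <= K ->
  (forall k, nrm (u k.+1 - u k) <= K * (1 - q) * q ^+ k) ->
  exists l, forall k, nrm (l - u k) <= K * q ^+ k.
Proof.
move=> /andP[q0 q1] K0 uq.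
have ukj k j : nrm (u (k + j)%N - u k) <= K * q ^+ k.
  (* The exact partial sum is needed for the induction on [j]; the weaker bound without [1 - q ^+ j]
     does not reproduce itself. *)
  have : nrm (u (k + j)%N - u k) <= K * q ^+ k * (1 - q ^+ j).
    elim: j => [|j IH]; first by rewrite addn0 !subrr seminorm0// mulr0.
    rewrite addnS (le_trans (seminorm_triangle semi (u (k + j)%N) _ _))//.
    have := lerD (uq (k + j)%N) IH; move/le_trans; apply.
    rewrite [leLHS](_ : _ = K * q ^+ k * (1 - q ^+ j.+1))//.
    by rewrite exprD exprS; ring.
  move/le_trans; apply; rewrite ler_piMr//; first by rewrite mulr_ge0// exprn_ge0.
  by rewrite gerBl exprn_ge0.
have [c c0 cN] := norm_equiv nrmP.
have cu : cauchy (u @ \oo).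
  apply: cauchy_exP => e e0.
  have qq : 0 <= q < 1 by rewrite q0.
  have cK : 0 <= c * K by rewrite mulr_ge0// ltW.
  have e2 : 0 < e / 2 by lra.
  have [k qk] := exists_expr_le qq cK e2.
  exists (u k); exists k => // m /= km; rewrite -ball_normE /= distrC.
  rewrite -(subnKC km) (le_lt_trans (cN _))//.
  rewrite (le_lt_trans (ler_wpM2l (ltW c0) (ukj _ _)))// mulrA.
  by lra.
have [l ul] : exists l : 'cV[R]_n, u @ \oo --> l.
  by exists (lim (u @ \oo)); exact: cauchy_cvg cu.
exists l => k; apply/ler_addgt0Pr => e e0.
have H : \forall m \near \oo, nrm (u m - l) <= e by exact: cvg_seminorm.
have [m [km me]] : exists m, (k <= m)%N /\ nrm (u m - l) <= e.
  have [m0 _ m0P] := H; exists (maxn k m0); split; first exact: leq_maxl.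
  by apply: m0P; exact: leq_maxr.
rewrite (le_trans (seminorm_triangle semi (u m) _ _))// addrC lerD//.
  by rewrite -(subnKC km).
by rewrite seminormBC.
Qed.

Variables (I : set R) (C L rho eps : R).
Notation continuous_in h := (forall t, I t -> h @ within I (nbhs t) --> h t).
(* [B h z]: [z] is the solution of [z' = A z + h] on [I] that is selected by a
   boundary condition making it bounded. *)
Variable B : (R -> 'cV[R]_n) -> (R -> 'cV[R]_n) -> Prop.
Hypothesis B0 : B (fun=> 0) (fun=> 0).
Hypothesis B_solve : forall (h : R -> 'cV[R]_n) M, continuous_in h ->
  (forall t, I t -> nrm (h t) <= M) -> exists z, B h z.
Hypothesis B_cont : forall h z : R -> 'cV[R]_n, B h z -> continuous_in z.
Hypothesis B_stable : forall h1 h2 z1 z2 M, B h1 z1 -> B h2 z2 ->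
  (forall t, I t -> nrm (h1 t - h2 t) <= M) ->
  forall t, I t -> nrm (z1 t - z2 t) <= C * M.

Notation bounded_in z := (forall t, I t -> nrm (z t) <= rho).
Variable Phi : (R -> 'cV[R]_n) -> R -> 'cV[R]_n.
Hypothesis Phi_cont : forall z : R -> 'cV[R]_n, continuous_in z -> bounded_in z ->
  continuous_in (Phi z).
Hypothesis Phi_lip : forall z1 z2 : R -> 'cV[R]_n, bounded_in z1 -> bounded_in z2 ->
  forall t, I t -> nrm (Phi z1 t - Phi z2 t) <= L * nrm (z1 t - z2 t).
Hypothesis Phi0 : forall t, I t -> nrm (Phi (fun=> 0) t) <= eps.
Hypotheses (C0 : 0 <= C) (L0 : 0 <= L) (rho0 : 0 <= rho) (CL : C * L < 1).
Hypothesis C_rho : C * (L * rho + eps) <= rho.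

(** Solving the linear problem with right-hand side [Phi z] maps the ball of radius [rho] into
    itself and contracts by [C * L]. Functions are controlled on [I] only, so the limit of the
    iteration and the solution it produces may differ elsewhere; hence [h] and [Phi z] are equated
    just on [I]. *)
Lemma bvp_fixed_point :
  exists h z, [/\ B h z, bounded_in z & forall t, I t -> h t = Phi z t].
Proof.
pose good (z : R -> 'cV[R]_n) := continuous_in z /\ bounded_in z.
have good0 : good (fun=> 0).
  by split=> t It; [exact: cvg_cst|rewrite seminorm0].
have Phi_bd z : good z -> forall t, I t -> nrm (Phi z t) <= L * rho + eps.
  move=> [_ bz] t It.
  rewrite -[Phi z t](subrK (Phi (fun=> 0) t)) (le_trans (semi.2 _ _))//.
  rewrite lerD ?Phi0// (le_trans (Phi_lip bz good0.2 It))// subr0.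
  by rewrite ler_wpM2l// bz.
have Bgood z w : good z -> B (Phi z) w -> good w.
  move=> gz Bw; split; first exact: B_cont Bw.
  move=> t It; rewrite -[w t]subr0 (le_trans _ C_rho)//.
  apply: (B_stable Bw B0) => // s Is; rewrite subr0; exact: Phi_bd.
(* [S] is one Picard step, made total by choice; outside [good] its value is unconstrained. *)
have [S SP] : {S & forall z, good z -> B (Phi z) (S z)}.
  apply: (choice (P := fun z w => good z -> B (Phi z) w)) => z.
  have [gz|ngz] := pselect (good z).
    have [w Bw] := B_solve (Phi_cont gz.1 gz.2) (Phi_bd z gz).
    by exists w.
  by exists (fun=> 0).
pose Z k := iter k S (fun=> 0).
have Zgood k : good (Z k).
  by elim: k => [//|k IH]; apply: Bgood (SP _ IH).
(* With this [K] the bound on the first increment, [K * (1 - q)], is [rho]. *)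
pose q := C * L; pose K := rho / (1 - q).
have q0 : 0 <= q by rewrite mulr_ge0.
have q1 : 0 < 1 - q by rewrite subr_gt0.
have K0 : 0 <= K by rewrite divr_ge0// ltW.
have Zq k t : I t -> nrm (Z k.+1 t - Z k t) <= K * (1 - q) * q ^+ k.
  rewrite /K divfK ?gt_eqF//.
  elim: k t => [|k IH] t It; first by rewrite mulr1 subr0; exact: (Zgood 1%N).2.
  rewrite exprS mulrCA -mulrA.
  apply: (B_stable (SP _ (Zgood k.+1)) (SP _ (Zgood k)) _ It) => s Is.
  rewrite (le_trans (Phi_lip (Zgood k.+1).2 (Zgood k).2 Is))//.
  by rewrite ler_wpM2l// IH.
(* The limit is chosen point by point, but the rate does not depend on [t], so convergence is
   uniform on [I] and continuity passes to the limit. *)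
have [z zP] : {z : R -> 'cV[R]_n &
    forall t, I t -> forall k, nrm (z t - Z k t) <= K * q ^+ k}.
  apply: (choice (P := fun t l => I t -> forall k, nrm (l - Z k t) <= K * q ^+ k)).
  move=> t; have [It|nIt] := pselect (I t); last by exists 0.
  have qq : 0 <= q < 1 by rewrite q0 CL.
  by have [l lP] := cvg_geometric_le qq K0 (fun k => Zq k t It); exists l.
have small e : 0 < e -> exists k, K * q ^+ k <= e.
  by apply: exists_expr_le => //; rewrite q0 CL.
have gz : good z.
  split=> t It.
    apply: (cvg_nrmP nrmP) => e e0.
    have e3 : 0 < e / 3 by lra.
    have [k kP] := small _ e3.
    have H : \forall s \near within I (nbhs t), nrm (Z k s - Z k t) <= e / 3.
      exact: (@cvg_seminorm _ _ _ _ semi _ _ (within_filter _ (nbhs_filter t))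
        _ _ _ e3 ((Zgood k).1 t It)).
    have {}H : nbhs t [set s | I s -> nrm (Z k s - Z k t) <= e / 3] by exact: H.
    suff : nbhs t [set s | I s -> nrm (z s - z t) <= e] by [].
    apply: filterS H => s /= H Is.
    rewrite (le_trans (seminorm_triangle semi (Z k s) _ _))//.
    have := seminorm_triangle semi (Z k t) (Z k s) (z t).
    have := zP s Is k; have := zP t It k; rewrite (seminormBC semi (z t)).
    by have := H Is; lra.
  apply/ler_addgt0Pr => e e0; have [k kP] := small _ e0.
  rewrite -[z t](subrK (Z k t)) (le_trans (semi.2 _ _))// addrC lerD//.
    exact: (Zgood k).2.
  exact: le_trans (zP t It k) kP.
have Bw := SP _ gz; have gw := Bgood _ _ gz Bw.
have zw t : I t -> z t = S z t.
  move=> It; apply/eqP; rewrite -subr_eq0; apply/eqP.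
  have [_ [nrm0 _]] := nrmP; apply: nrm0; apply/eqP.
  rewrite eq_le seminorm_ge0// andbT; apply/ler_addgt0Pr => e e0.
  have e2 : 0 < e / 2 by lra.
  have [k kP] := small _ e2.
  have H1 := zP t It k.+1.
  have H2 : nrm (Z k.+1 t - S z t) <= C * (L * (K * q ^+ k)).
    apply: (B_stable (SP _ (Zgood k)) Bw _ It) => s Is.
    rewrite (le_trans (Phi_lip (Zgood k).2 gz.2 Is))// ler_wpM2l//.
    by rewrite seminormBC//; exact: zP.
  have H3 : K * q ^+ k.+1 <= K * q ^+ k.
    by rewrite ler_wpM2l// exprS ler_piMl ?exprn_ge0// ltW.
  have H4 : C * (L * (K * q ^+ k)) = K * q ^+ k.+1 by rewrite exprS /q; ring.
  have := seminorm_triangle semi (Z k.+1 t) (z t) (S z t).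
  by rewrite add0r; lra.
(* The solution returned is [S z], for which [B] is known; [Phi] takes the same values at [z] and
   [S z] on [I] by the Lipschitz bound. *)
exists (Phi z), (S z); split=> //; first exact: gw.2.
move=> t It; apply/eqP; rewrite -subr_eq0; apply/eqP.
have [nrm_ge0 [nrm0 _]] := nrmP; apply: nrm0; apply/eqP.
rewrite eq_le nrm_ge0 andbT (le_trans (Phi_lip gz.2 gw.2 It))//.
by rewrite -zw// subrr seminorm0// mulr0.
Qed.

End FixedPoint.

(** * Limits at the right end of an interval *)

Section HalfOpenInterval.
Context {R : realType}.
Variables (n : nat) (nrm : 'cV[R]_n -> R).
Hypothesis nrmP : is_norm nrm.
Let semi : seminorm nrm := is_norm_seminorm nrmP.

(** Domination makes [phi] nondecreasing on [I], and [G] is Cauchy along points where [phi]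
    approaches its supremum. Measuring closeness to the end by [phi] treats finite and infinite ends
    alike. *)
Lemma limit_at_end (I : set R) (G : R -> 'cV[R]_n) (phi : R -> R) :
  has_sup (phi @` I) ->
  (forall a b, I a -> I b -> a <= b -> nrm (G b - G a) <= phi b - phi a) ->
  exists l, forall e, 0 < e ->
    exists2 a, I a & forall b, I b -> a <= b -> nrm (G b - l) <= e.
Proof.
move=> phi_sup dG; pose s := sup (phi @` I).
have phis a : I a -> phi a <= s.
  by move=> Ia; apply: ub_le_sup; [case: phi_sup|exists a].
have ex k : exists a, I a /\ s - 2^-1 ^+ k < phi a.
  have k0 : 0 < (2^-1 : R) ^+ k by rewrite exprn_gt0.
  by have [_ [a Ia <-] ?] := sup_adherent k0 phi_sup; exists a.
have [u uP] := choice ex.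
have dGn a b : I a -> I b -> nrm (G b - G a) <= `|phi b - phi a|.
  move=> Ia Ib; have [ab|/ltW ba] := leP a b.
    by rewrite (le_trans (dG _ _ Ia Ib ab))// ler_norm.
  by rewrite seminormBC// distrC (le_trans (dG _ _ Ib Ia ba))// ler_norm.
have Gu k b : I b -> s - 2^-1 ^+ k < phi b ->
    nrm (G b - G (u k)) <= 2^-1 ^+ k.
  move=> Ib sb; have [Iu su] := uP k; rewrite (le_trans (dGn _ _ Iu Ib))//.
  by rewrite ler_norml; have := phis _ Ib; have := phis _ Iu; lra.
have half : 0 <= (2^-1 : R) < 1 by lra.
have Gk k : nrm ((G \o u) k.+1 - (G \o u) k) <= 2 * (1 - 2^-1) * 2^-1 ^+ k.
  rewrite /= (_ : 2 * (1 - 2^-1) = 1) ?mul1r; last by lra.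
  have [Iu su] := uP k.+1; apply: Gu => //.
  have : (2^-1 : R) ^+ k.+1 <= 2^-1 ^+ k.
    by rewrite exprS ler_piMl ?exprn_ge0//; lra.
  by lra.
have [l lP] := cvg_geometric_le nrmP half (ler0n R 2) Gk.
(* The 3 is 1 for the distance from [G b] to [G (u k)] plus 2 for that from [G (u k)] to [l]. *)
exists l => e e0; have [k ke] := exists_expr_le half (ler0n R 3) e0.
have [Iu su] := uP k; exists (u k) => // b Ib ub.
rewrite (le_trans (seminorm_triangle semi (G (u k)) _ _))//.
have := lP k; rewrite seminormBC//=.
have : nrm (G b - G (u k)) <= 2^-1 ^+ k.
  apply: Gu => //; have := dG _ _ Iu Ib ub.
  by have := seminorm_ge0 semi (G b - G (u k)); lra.
by lra.
Qed.

End HalfOpenInterval.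

(** * The inhomogeneous linear equation and its bounded solutions *)

Section LinearInhomogeneous.
Context {R : realType}.
Variables (n : nat) (nrm : 'cV[R]_n -> R) (A : R -> 'M[R]_n).
Variables (T : R -> R -> 'M[R]_n) (N lam : R) (tau : \bar R).
Hypotheses (nrmP : is_norm nrm) (TA : transition_matrix A T).
Hypotheses (N0 : 0 < N) (lam0 : 0 < lam) (tau0 : (0 < tau)%E).
Notation I := (Ico0 tau).
Notation J := [set t : R | 0 <= t].
Let semi : seminorm nrm := is_norm_seminorm nrmP.

Definition inhomogeneous (h z : R -> 'cV[R]_n) :=
  has_deriv_on I z (fun t => A t *m z t + h t).

Let IJ : I `<=` J. Proof. by move=> t []. Qed.

Lemma inhomogeneousB h1 h2 z1 z2 : inhomogeneous h1 z1 -> inhomogeneous h2 z2 ->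
  inhomogeneous (fun t => h1 t - h2 t) (fun t => z1 t - z2 t).
Proof.
move=> d1 d2 t It; have := has_derivB (d1 t It) (d2 t It).
by rewrite mulmxBr opprD addrACA.
Qed.

Lemma inhomogeneous0 : inhomogeneous (fun=> 0) (fun=> 0).
Proof. by move=> t It; rewrite mulmx0 addr0; exact: has_deriv_cst. Qed.

(** The terms containing [A s] cancel, so the mean value inequality sees only [h]. *)
Lemma inhomogeneous_pullback h z t s : inhomogeneous h z -> 0 <= t -> I s ->
  has_deriv_at I (fun s => T t s *m z s) s (T t s *m h s).
Proof.
move=> dz t0 Is; have s0 := IJ Is.
have dT := has_deriv_subset IJ (has_deriv_transition TA s0 t0).
have := has_deriv_mulmx Is dT (dz s Is).
by rewrite mulmxDr mulNmx !mulmxA addrA addNr add0r.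
Qed.

(** The vector [c] stays free so that a condition can be imposed at either end: c = 0 gives z(0) =
    0, and the limit of [G] at the right end gives the solution vanishing there. *)
Lemma variation_of_constants (h : R -> 'cV[R]_n) :
  (forall t, I t -> h @ within I (nbhs t) --> h t) ->
  exists G, [/\ G 0 = 0, has_deriv_on I G (fun s => T 0 s *m h s) &
    forall c, inhomogeneous h (fun t => T t 0 *m (G t - c))].
Proof.
move=> ch.
have cTh t : I t ->
    (fun s => T 0 s *m h s) @ within I (nbhs t) --> T 0 t *m h t.
  move=> It; apply: cvg_mulmx; last exact: ch.
  have dT := has_deriv_transition TA (IJ It) (lexx 0).
  exact: has_deriv_continuous (has_deriv_subset IJ dT).
have [G [dG G0]] := antiderivative tau0 cTh.
exists G; split=> // c t It.
have dT := has_deriv_subset IJ ((TA (lexx 0)).2 _ (IJ It)).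
have dGc := has_derivB (dG t It) (@has_deriv_cst R n 1 I c t).
have := has_deriv_mulmx It dT dGc; rewrite subr0 !mulmxA.
by rewrite -(transition_split TA (IJ It) (IJ It)) (TA (IJ It)).1 mul1mx.
Qed.

Lemma is_derive_expR_affine (k c s : R) :
  is_derive s 1 (fun s => k * expR (c * s)) (k * (c * expR (c * s))).
Proof.
have dcs : is_derive s 1 (fun s : R => c * s) c.
  have := is_deriveZ c (is_derive_id s (1 : R)).
  by rewrite /GRing.scale /= mulr1.
have := is_derive1_comp (is_derive_expR (c * s)) dcs.
move=> /(is_deriveZ k); rewrite /GRing.scale /= [expR _ * c]mulrC.
by [].
Qed.

Lemma cvg_within_Ico0 p q (X : R -> 'M[R]_(p, q)) :
  {within J, continuous X} -> forall t, I t -> X @ within I (nbhs t) --> X t.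
Proof.
move=> /subspace_continuousP cX t It B XB.
have H : nbhs t [set s | J s -> B (X s)] by exact: cX (IJ It) _ XB.
suff : nbhs t [set s | I s -> B (X s)] by [].
by apply: filterS H => s /= H /IJ; exact: H.
Qed.

(** * Zero initial value, for an exponential contraction *)

Section Contraction.
Hypothesis ctr : exp_contraction nrm T N lam.

Definition bvp_contraction (h z : R -> 'cV[R]_n) := inhomogeneous h z /\ z 0 = 0.

Lemma bvp_contraction_solve (h : R -> 'cV[R]_n) M :
  (forall t, I t -> h @ within I (nbhs t) --> h t) ->
  (forall t, I t -> nrm (h t) <= M) -> exists z, bvp_contraction h z.
Proof.
move=> ch _; have [G [G0 _ dz]] := variation_of_constants ch.
by exists (fun t => T t 0 *m (G t - 0)); split=> //; rewrite G0 subr0 mulmx0.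
Qed.

Lemma bvp_contraction_stable h1 h2 z1 z2 M :
  bvp_contraction h1 z1 -> bvp_contraction h2 z2 ->
  (forall t, I t -> nrm (h1 t - h2 t) <= M) ->
  forall t, I t -> nrm (z1 t - z2 t) <= N / lam * M.
Proof.
move=> [d1 z10] [d2 z20] hM t It; have dz := inhomogeneousB d1 d2.
have t0 := IJ It; have M0 : 0 <= M.
  by rewrite (le_trans _ (hM t It))// seminorm_ge0.
have [_ [_ [_ [_ [cT _]]]]] := ctr.
(* Makes the derivative of [k * expR (lam * s)] equal to N M exp(- lam (t - s)), the dichotomy bound
   for T(t,s) applied to the difference of [h1] and [h2]. *)
pose k := N * M / lam * expR (- lam * t).
have k0 : 0 <= k by rewrite mulr_ge0 ?expR_ge0// divr_ge0 ?mulr_ge0// ltW.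
have : nrm (T t t *m (z1 t - z2 t) - T t 0 *m (z1 0 - z2 0))
    <= k * expR (lam * t) - k * expR (lam * 0).
  apply: (@mean_value_le R n 1 nrm I (fun s => T t s *m (z1 s - z2 s))
    (fun s => T t s *m (h1 s - h2 s)) (fun s => k * expR (lam * s))
    (fun s => k * (lam * expR (lam * s)))) => // s /andP[s0 st].
  have Is := Ico0_le s0 st It; split=> //.
  - exact: (inhomogeneous_pullback dz).
  - exact: is_derive_expR_affine.
  rewrite (le_trans (opnorm_le nrmP _ _))//.
  have := cT t s s0 st; rewrite mulmx1 => H.
  apply: (le_trans (ler_wpM2r (seminorm_ge0 semi _) H)).
  apply: (le_trans (ler_wpM2l _ (hM s Is))).
    by rewrite mulr_ge0 ?expR_ge0// ltW.
  rewrite (_ : - lam * (t - s) = - lam * t + lam * s); last by ring.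
  rewrite expRD /k le_eqVlt; apply/orP; left; apply/eqP; field.
  by rewrite gt_eqF.
rewrite (TA t0).1 mul1mx z10 z20 subrr mulmx0 subr0 mulr0 expR0 mulr1.
move/le_trans; apply; rewrite /k -mulrA -expRD mulNr addNr expR0 mulr1.
have -> : N / lam * M = N * M / lam by rewrite mulrAC.
by move: k0; rewrite /k mulNr; lra.
Qed.

End Contraction.

(** * Vanishing condition at the right end, for an exponential expansion *)

Section Expansion.
Hypothesis expn : exp_expansion nrm T N lam.

Let expT t s : 0 <= t -> t <= s -> forall x,
  nrm (T t s *m x) <= N * expR (- lam * (s - t)) * nrm x.
Proof.
move=> t0 ts x; rewrite (le_trans (opnorm_le nrmP _ _))//.
have [_ [_ [_ [_ [_ H]]]]] := expn.
have := H t s t0 ts; rewrite subr0 mulmx1.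
by apply: ler_wpM2r; exact: seminorm_ge0.
Qed.

(* Singles out [z(t) = - int_t^tau T(t,s) h(s) ds] among the solutions of
   [z' = A z + h]. *)
Definition vanishing_at_end (z : R -> 'cV[R]_n) := forall e, 0 < e ->
  exists2 a, I a & forall b, I b -> a <= b -> nrm (T 0 b *m z b) <= e.

Definition bvp_expansion (h z : R -> 'cV[R]_n) :=
  inhomogeneous h z /\ vanishing_at_end z.

Let I0 : I 0.
Proof. by split. Qed.

(** The derivative of [phi] is N M exp(- lam (s - t)), and [phi] stays nonpositive, so increments
    are bounded uniformly in [b]. The case t = 0 yields the limit of [G], the case t = a the
    stability bound. *)
Let expansion_increment h t a b M (y : R -> 'cV[R]_n) : 0 <= M -> I b ->
  0 <= t -> t <= a -> a <= b ->
  (forall s, I s -> has_deriv_at I y s (T t s *m h s)) ->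
  (forall s, I s -> nrm (h s) <= M) ->
  let phi s := - (N * M / lam * expR (lam * t)) * expR (- lam * s) in
  nrm (y b - y a) <= phi b - phi a.
Proof.
move=> M0 Ib t0 ta ab dy hM.
pose k := - (N * M / lam * expR (lam * t)).
apply: (@mean_value_le R n 1 nrm I y (fun s => T t s *m h s)
  (fun s => k * expR (- lam * s))
  (fun s => k * (- lam * expR (- lam * s)))) => // s /andP[as_ sb].
have ts := le_trans ta as_.
have Is := Ico0_le (le_trans t0 ts) sb Ib; split=> //.
- exact: dy.
- exact: is_derive_expR_affine.
rewrite (le_trans (expT t0 ts _))//.
apply: (le_trans (ler_wpM2l _ (hM s Is))).
  by rewrite mulr_ge0 ?expR_ge0// ltW.
rewrite (_ : - lam * (s - t) = lam * t + - lam * s); last by ring.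
rewrite expRD /k le_eqVlt; apply/orP; left; apply/eqP; field.
by rewrite gt_eqF.
Qed.

Lemma bvp_expansion_solve (h : R -> 'cV[R]_n) M :
  (forall t, I t -> h @ within I (nbhs t) --> h t) ->
  (forall t, I t -> nrm (h t) <= M) -> exists z, bvp_expansion h z.
Proof.
move=> ch hM; have [G [_ dG dz]] := variation_of_constants ch.
have M0 : 0 <= M by rewrite (le_trans _ (hM 0 I0))// seminorm_ge0.
pose phi s := - (N * M / lam * expR (lam * 0)) * expR (- lam * s).
have k0 : 0 <= N * M / lam * expR (lam * 0).
  by rewrite mulr_ge0 ?expR_ge0// divr_ge0 ?mulr_ge0// ltW.
have phi_sup : has_sup (phi @` I).
  split; first by exists (phi 0), 0.
  exists 0 => _ [s _ <-]; rewrite /phi mulNr oppr_le0.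
  by rewrite mulr_ge0// expR_ge0.
have dGphi a b : I a -> I b -> a <= b -> nrm (G b - G a) <= phi b - phi a.
  by move=> Ia Ib ab; apply: (expansion_increment M0 Ib (lexx 0) (IJ Ia) ab dG hM).
have [l lP] := limit_at_end nrmP phi_sup dGphi.
(* Pulled back to time 0 this solution is [G t - l], which tends to 0. *)
exists (fun t => T t 0 *m (G t - l)); split=> // e e0.
have [a Ia aP] := lP e e0; exists a => // b Ib ab.
rewrite mulmxA (transition_comp0 TA (IJ Ib) (lexx 0)) (TA (lexx 0)).1 mul1mx.
exact: aP.
Qed.

Lemma bvp_expansion_stable h1 h2 z1 z2 M :
  bvp_expansion h1 z1 -> bvp_expansion h2 z2 ->
  (forall t, I t -> nrm (h1 t - h2 t) <= M) ->
  forall t, I t -> nrm (z1 t - z2 t) <= N / lam * M.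
Proof.
move=> [d1 v1] [d2 v2] hM t It; have dz := inhomogeneousB d1 d2.
have t0 := IJ It; have M0 : 0 <= M.
  by rewrite (le_trans _ (hM t It))// seminorm_ge0.
(* The pulled-back difference is compared between [t] and some [u] near the end. Since T(t,u) =
   T(t,0) T(0,u) with [t] fixed, tolerance [e / (2 * c)] for each of [z1], [z2] makes the term at
   [u] at most [e]. *)
apply/ler_addgt0Pr => e e0; pose c := `|opnorm nrm (T t 0)| + 1.
have c0 : 0 < c by rewrite ltr_wpDl.
have e1 : 0 < e / (2 * c) by rewrite divr_gt0// mulr_gt0.
have [a1 Ia1 H1] := v1 _ e1; have [a2 Ia2 H2] := v2 _ e1.
pose u := Num.max t (Num.max a1 a2).
have tu : t <= u by rewrite le_max lexx.
have Iu : I u by rewrite /u; case: leP => _ //; case: leP.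
have {}H1 := H1 u Iu; have {}H2 := H2 u Iu.
have {H1 H2} zu : nrm (T 0 u *m (z1 u - z2 u)) <= e / c.
  rewrite mulmxBr (le_trans (seminormB_le semi _ _))//.
  have -> : e / c = e / (2 * c) + e / (2 * c) by field; rewrite gt_eqF.
  by rewrite lerD// ?H1 ?H2// !le_max lexx !orbT.
have {}zu : nrm (T t u *m (z1 u - z2 u)) <= e.
  rewrite (transition_split TA (IJ Iu) t0) -mulmxA.
  rewrite (le_trans (opnorm_le nrmP _ _))//.
  have := seminorm_ge0 semi (T 0 u *m (z1 u - z2 u)).
  move: zu; rewrite ler_pdivlMr// /c; have := ler_norm (opnorm nrm (T t 0)).
  by nra.
have dy s : I s -> has_deriv_at I (fun s => T t s *m (z1 s - z2 s)) s
    (T t s *m (h1 s - h2 s)).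
  by move=> Is; exact: (inhomogeneous_pullback dz).
have /= := expansion_increment M0 Iu t0 (lexx t) tu dy hM.
rewrite (TA t0).1 mul1mx => H.
have k1 : N * M / lam * expR (lam * t) * expR (- lam * t) = N * M / lam.
  by rewrite -mulrA -expRD mulNr subrr expR0 mulr1.
have := seminorm_triangle semi (T t u *m (z1 u - z2 u)) 0 (z1 t - z2 t).
rewrite !sub0r !seminormN// => {}H3.
have k0 : 0 <= N * M / lam * expR (lam * t) * expR (- lam * u).
  by rewrite !mulr_ge0 ?expR_ge0 ?invr_ge0// ltW.
have -> : N / lam * M = N * M / lam by rewrite mulrAC.
by lra.
Qed.

Lemma bvp_expansion0 : bvp_expansion (fun=> 0) (fun=> 0).
Proof.
split; first exact: inhomogeneous0.
by move=> e e0; exists 0 => // b _ _; rewrite mulmx0 seminorm0// ltW.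
Qed.

End Expansion.

End LinearInhomogeneous.

(** * From bounded solvability of the linear problem to shadowing *)

Section Shadowing.
Context {R : realType}.
Variables (n : nat) (nrm : 'cV[R]_n -> R) (H : set 'cV[R]_n).
Variables (A : R -> 'M[R]_n) (f : R -> 'cV[R]_n -> 'cV[R]_n).
Variables (C delta L : R).
Hypothesis nrmP : is_norm nrm.
Hypothesis cA : {within [set t : R | 0 <= t], continuous A}.
Hypothesis cf : {within [set p : R * 'cV[R]_n | 0 <= p.1],
  continuous (fun p => f p.1 p.2)}.
Hypothesis f_lip : forall t x1 x2, 0 <= t -> nbhd_set nrm delta H x1 ->
  nbhd_set nrm delta H x2 -> nrm (f t x1 - f t x2) <= L * nrm (x1 - x2).
Hypotheses (C0 : 0 < C) (delta0 : 0 < delta) (L0 : 0 < L) (CL : C * L < 1).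
Let semi : seminorm nrm := is_norm_seminorm nrmP.

Variable B : \bar R -> (R -> 'cV[R]_n) -> (R -> 'cV[R]_n) -> Prop.
Hypothesis B_inhomogeneous : forall tau h z, (0 < tau)%E ->
  B tau h z -> inhomogeneous A tau h z.
Hypothesis B0 : forall tau, (0 < tau)%E -> B tau (fun=> 0) (fun=> 0).
Hypothesis B_solve : forall tau (h : R -> 'cV[R]_n) M, (0 < tau)%E ->
  (forall t, Ico0 tau t -> h @ within (Ico0 tau) (nbhs t) --> h t) ->
  (forall t, Ico0 tau t -> nrm (h t) <= M) -> exists z, B tau h z.
Hypothesis B_stable : forall tau h1 h2 z1 z2 M, (0 < tau)%E ->
  B tau h1 z1 -> B tau h2 z2 ->
  (forall t, Ico0 tau t -> nrm (h1 t - h2 t) <= M) ->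
  forall t, Ico0 tau t -> nrm (z1 t - z2 t) <= C * M.

(** Abstracting over the boundary condition [B] serves contraction and expansion at once; [C] is
    common to all [tau], so [eps0] and [kappa] do not depend on the interval. *)
Lemma cond_lip_shadowing_of_bvp :
  cond_lip_shadowing nrm (fun t x => A t *m x + f t x) H.
Proof.
(* The solution of kappa = C (L kappa + 1), which makes the ball of radius [kappa * eps] invariant
   under the Picard step. *)
pose kappa := C / (1 - C * L).
have CL1 : 0 < 1 - C * L by rewrite subr_gt0.
have kappa0 : 0 < kappa by rewrite divr_gt0.
exists (delta / kappa), kappa; split; first exact: divr_gt0.
split=> // eps tau y yd eps0 epsle tau0 [dy [cyd yeps]] Hy.
set I := Ico0 tau in dy cyd yeps Hy *.
have rho_le : kappa * eps <= delta by rewrite mulrC -ler_pdivlMr.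
(* [z' = A z + Phi z] means that [y + z] solves the equation *)
pose Phi (z : R -> 'cV[R]_n) t : 'cV[R]_n := f t (y t + z t) - (yd t - A t *m y t).
have cy t : I t -> y @ within I (nbhs t) --> y t.
  by move=> It; exact: has_deriv_continuous (dy t It).
have inH z t : I t -> nrm z <= kappa * eps -> nbhd_set nrm delta H (y t + z).
  move=> It zrho; exists (y t); first exact: Hy.
  by rewrite /cball /= addrC addKr (le_trans zrho).
have Phi_cont (z : R -> 'cV[R]_n) : (forall t, I t -> z @ within I (nbhs t) --> z t) ->
    forall t, I t -> Phi z @ within I (nbhs t) --> Phi z t.
  move=> cz t It.
  have cyz : (fun s => (s, y s + z s)) @ within I (nbhs t) --> (t, y t + z t).
    have ct : (fun s : R => s) @ within I (nbhs t) --> t by exact: cvg_within.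
    exact: (cvg_pair ct (cvgD (cy t It) (cz t It))).
  apply: cvgB.
    move=> V HV; have t0 : 0 <= (t, y t + z t).1 by case: It.
    have {}HV : nbhs (t, y t + z t)
        [set p : R * 'cV[R]_n | 0 <= p.1 -> V (f p.1 p.2)].
      by have /subspace_continuousP := cf; move=> /(_ _ t0 V HV).
    have {}HV : nbhs t [set s | I s -> 0 <= s -> V (f s (y s + z s))].
      exact: cyz _ HV.
    suff : nbhs t [set s | I s -> V (f s (y s + z s))] by [].
    by apply: filterS HV => s /= HV Is; apply: HV => //; case: Is.
  apply: cvgB; first by have /subspace_continuousP := cyd; apply.
  apply: cvg_mulmx; last exact: cy.
  exact: cvg_within_Ico0 cA _ It.
have Phi_lip z1 z2 : (forall t, I t -> nrm (z1 t) <= kappa * eps) ->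
    (forall t, I t -> nrm (z2 t) <= kappa * eps) ->
    forall t, I t -> nrm (Phi z1 t - Phi z2 t) <= L * nrm (z1 t - z2 t).
  move=> b1 b2 t It.
  have -> : Phi z1 t - Phi z2 t = f t (y t + z1 t) - f t (y t + z2 t).
    by rewrite /Phi; move: (yd t - _) => b; rewrite opprB addrA subrK.
  have -> : z1 t - z2 t = (y t + z1 t) - (y t + z2 t).
    by rewrite opprD addrACA subrr add0r.
  by apply: f_lip; [case: It|exact/inH/b1|exact/inH/b2].
have Phi0 t : I t -> nrm (Phi (fun=> 0) t) <= eps.
  move=> It; rewrite (le_trans _ (yeps t It))// /Phi addr0 seminormBC//.
  by rewrite opprD addrA.
have B_cont h z : B tau h z -> forall t, I t -> z @ within I (nbhs t) --> z t.
  move=> /(B_inhomogeneous tau0) dz t It.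
  exact: has_deriv_continuous (dz t It).
have rho0 : 0 <= kappa * eps by rewrite mulr_ge0// ltW.
have C_rho : C * (L * (kappa * eps) + eps) <= kappa * eps.
  rewrite le_eqVlt; apply/orP; left; apply/eqP; rewrite /kappa; field.
  by rewrite gt_eqF.
have [h [z [Bz zrho hPhi]]] := bvp_fixed_point nrmP (B0 tau0)
  (fun h M => @B_solve tau h M tau0) B_cont
  (fun h1 h2 z1 z2 M => @B_stable tau h1 h2 z1 z2 M tau0)
  (fun z cz _ => Phi_cont z cz) Phi_lip Phi0 (ltW C0) (ltW L0) rho0 CL C_rho.
have dz := B_inhomogeneous tau0 Bz.
exists (fun t => y t + z t); split; last first.
  by move=> t It; rewrite addrC addKr zrho.
exists (fun t => A t *m (y t + z t) + f t (y t + z t)); split=> // t It.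
(* The sum y + z is differentiated as y - (0 - z). *)
have := has_derivB (dy t It) (has_derivB (@has_deriv_cst R n 1 I 0 t) (dz t It)).
rewrite sub0r opprK hPhi// /Phi.
rewrite (_ : yd t + _ = A t *m (y t + z t) + f t (y t + z t)); last first.
  rewrite mulmxDr opprB !addrA; move: (A t *m y t) (A t *m z t) => a b.
  move: (f _ _) => c; rewrite addrC; apply/matrixP => i j; rewrite !mxE; ring.
apply: has_deriv_ext => // s _; rewrite sub0r opprK//.
Qed.

End Shadowing.

Theorem theorem3 (R : realType) (n : nat) (nrm : 'cV[R]_n -> R)
  (H : set 'cV[R]_n) (A : R -> 'M[R]_n) (f : R -> 'cV[R]_n -> 'cV[R]_n)
  (T : R -> R -> 'M[R]_n) (N lam delta L : R) :
  is_norm nrm ->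
  H !=set0 ->
  {within [set t : R | 0 <= t], continuous A} ->
  {within [set p : R * 'cV[R]_n | 0 <= p.1], continuous (fun p => f p.1 p.2)} ->
  transition_matrix A T ->
  0 < N -> 0 < lam ->
  exp_contraction nrm T N lam \/ exp_expansion nrm T N lam ->
  0 < delta -> 0 < L ->
  (forall t x1 x2, 0 <= t -> nbhd_set nrm delta H x1 -> nbhd_set nrm delta H x2 ->
     nrm (f t x1 - f t x2) <= L * nrm (x1 - x2)) ->
  L < lam / N ->
  cond_lip_shadowing nrm (fun t x => A t *m x + f t x) H.
Proof.
move=> nrmP _ cA cf TA N0 lam0 dich delta0 L0 f_lip LN.
have C0 : 0 < N / lam by rewrite divr_gt0.
have CL : N / lam * L < 1.
  by rewrite mulrAC ltr_pdivrMr// mul1r mulrC -ltr_pdivlMr.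
case: dich => [ctr|expn].
- apply: (@cond_lip_shadowing_of_bvp R n nrm H A f (N / lam) delta L nrmP cA cf
    f_lip C0 delta0 L0 CL (bvp_contraction A)).
  + by move=> tau h z _ [].
  + by move=> tau tau0; split=> //; exact: inhomogeneous0.
  + by move=> tau h M tau0; exact: (bvp_contraction_solve TA tau0).
  + by move=> tau h1 h2 z1 z2 M tau0;
      exact: (bvp_contraction_stable nrmP TA N0 lam0 ctr).
- apply: (@cond_lip_shadowing_of_bvp R n nrm H A f (N / lam) delta L nrmP cA cf
    f_lip C0 delta0 L0 CL (bvp_expansion nrm A T)).
  + by move=> tau h z _ [].
  + by move=> tau tau0; exact: bvp_expansion0.
  + by move=> tau h M tau0; exact: (bvp_expansion_solve nrmP TA N0 lam0 tau0 expn).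
  + by move=> tau h1 h2 z1 z2 M tau0;
      exact: (bvp_expansion_stable nrmP TA N0 lam0 expn).
Qed.
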